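(* There is a group law $\oplus$ on the elliptic curve $E$ such that each element of $\Gamma$ acts on $E$ as translation by a point of the 2-torsion subgroup $E[2]$.
   Context: Let $k$ be an algebraically closed field of characteristic not $2$, and let $\alpha,\beta,\gamma\in k$ satisfy $\alpha+\beta+\gamma+\alpha\beta\gamma=0$ and $\{\alpha,\beta,\gamma\}\cap\{0,1,-1\}=\varnothing$. Let $E\subset\mathbb P^3$ (homogeneous coordinates $x_0,x_1,x_2,x_3$) be the intersection of the quadrics $$x_0^2+x_1^2+x_2^2+x_3^2=0,\qquad (1-\gamma)x_1^2+(1+\alpha\gamma)x_2^2+(1+\alpha)x_3^2=0.$$ $E$ is an elliptic curve (a smooth irreducible curve of genus 1). A group law on $E$ means one making $E$ an algebraic group; $E[2]=\{v\in E: v\oplus v=o\}$, where $o$ is the identity. The group $\Gamma=\{1,\gamma_1,\gamma_2,\gamma_3=\gamma_1\gamma_2\}\cong\mathbb Z/2\times\mathbb Z/2$ acts on $\mathbb P^3$ by $\gamma_1(\delta_0,\delta_1,\delta_2,\delta_3)=(\delta_0,\delta_1,-\delta_2,-\delta_3)$, $\gamma_2(\delta_0,\delta_1,\delta_2,\delta_3)=(\delta_0,-\delta_1,\delta_2,-\delta_3)$, $\gamma_3(\delta_0,\delta_1,\delta_2,\delta_3)=(\delta_0,-\delta_1,-\delta_2,\delta_3)$, and this action preserves $E$. *)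

(* Defs.v *)
From HB Require Import structures.
From mathcomp Require Import all_boot all_order all_algebra.
From mathcomp Require Import generic_quotient mpoly.

Set Implicit Arguments.
Unset Strict Implicit.
Unset Printing Implicit Defensive.

Import GRing.Theory.
Local Open Scope ring_scope.
Local Open Scope quotient_scope.

Section ProjectiveSpace.

Variables (k : fieldType) (n : nat).

Definition nzvec := {v : 'rV[k]_n.+1 | v != 0}.

(* Two nonzero vectors represent the same point when they span the same line. *)
Definition same_line : rel nzvec := fun u v => (val u == val v)%MS.

Lemma same_lineP (u v : nzvec) :
  reflect (exists2 c, c != 0 & val u = c *: val v) (same_line u v).
Proof.
apply: (iffP idP) => [/andP[/sub_rVP[c uE] _]|[c c0 uE]].
  exists c => //; apply: contraNneq (valP u) => c0.
  by rewrite uE c0 scale0r.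
by rewrite /same_line uE; apply/eqmxP/eqmx_scale.
Qed.

Lemma same_line_refl : reflexive same_line.
Proof. by move=> u; apply/eqmxP. Qed.

Lemma same_line_sym : ssrbool.symmetric same_line.
Proof. by move=> u v; rewrite /same_line andbC. Qed.

Lemma same_line_trans : transitive same_line.
Proof.
move=> v u w /eqmxP uv /eqmxP vw; apply/eqmxP.
exact: eqmx_trans uv vw.
Qed.

Canonical same_line_equiv :=
  EquivRel same_line same_line_refl same_line_sym same_line_trans.

Definition pspace := {eq_quot same_line}.

HB.instance Definition _ := Choice.on pspace.
HB.instance Definition _ := EqQuotient.on pspace.

(* A vector of homogeneous coordinates of a point; only defined up to a nonzero
   scalar, so it is only used below in scaling-invariant conditions. *)
Definition hcoord (p : pspace) : 'rV[k]_n.+1 := val (repr p).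

Lemma hcoord_neq0 p : hcoord p != 0.
Proof. exact: valP (repr p). Qed.

Definition proj_point (v : 'rV[k]_n.+1) (v0 : v != 0) : pspace :=
  \pi_pspace (exist _ v v0 : nzvec).

Lemma eq_proj_point u v (u0 : u != 0) (v0 : v != 0) :
  reflect (exists2 c, c != 0 & u = c *: v) (proj_point u0 == proj_point v0).
Proof.
have -> : (proj_point u0 == proj_point v0)
          = same_line (exist _ u u0) (exist _ v v0).
  by rewrite /proj_point eqquotE.
exact: same_lineP (exist _ u u0) (exist _ v v0).
Qed.

Lemma hcoordK p : proj_point (hcoord_neq0 p) = p.
Proof.
rewrite -[RHS]reprK /proj_point; congr \pi; exact/val_inj.
Qed.

Lemma proj_pointP v (v0 : v != 0) p :
  reflect (exists2 c, c != 0 & v = c *: hcoord p) (p == proj_point v0).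
Proof. by rewrite eq_sym -{2}(hcoordK p); apply: eq_proj_point. Qed.

End ProjectiveSpace.

Notation "''P[' k ]_ n" := (pspace k n)
  (at level 8, n at level 2, format "''P[' k ]_ n") : type_scope.

Section RegularMaps.

Variable k : fieldType.

Definition zero_locus n (S : seq {mpoly k[n.+1]}) : pred 'P[k]_n :=
  fun p => all (fun F => F.@[hcoord p 0] == 0) S.

Lemma meval_homogZ n d (F : {mpoly k[n]}) (c : k) (v : 'rV[k]_n) :
  F \is d.-homog -> F.@[(c *: v) 0] = c ^+ d * F.@[v 0].
Proof.
move=> /dhomogP homF; rewrite !mevalE mulr_sumr; apply: eq_big_seq => m Fm.
rewrite mulrCA; congr (_ * _).
rewrite -(homF m Fm : mdeg m = d) mdegE -prodrXr -big_split.
by apply: eq_bigr => i _; rewrite mxE exprMn.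
Qed.

Lemma zero_locusE n (S : seq {mpoly k[n.+1]}) v (v0 : v != 0) :
  (forall F, F \in S -> F \is homog mdeg) ->
  (proj_point v0 \in zero_locus S) = all (fun F => F.@[v 0] == 0) S.
Proof.
move=> homS; have [c c0 vE] := proj_pointP v0 _ (eqxx _).
rewrite unfold_in; apply: eq_in_all => F /homS/homogP[d Fd].
by rewrite [in RHS]vE (meval_homogZ _ _ Fd) mulf_eq0 expf_eq0 (negPf c0) andbF.
Qed.

Definition mdegl n m (M : 'X_{1..n + m}) : nat :=
  (\sum_(i < n) M (lshift m i))%N.
Definition mdegr n m (M : 'X_{1..n + m}) : nat :=
  (\sum_(j < m) M (rshift n j))%N.

Definition bihomog n m d e : pred {mpoly k[n + m]} :=
  fun F => all (fun M => (mdegl M == d) && (mdegr M == e)) (msupp F).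

Definition represents r (F : 'I_r.+1 -> k) (q : 'P[k]_r) : Prop :=
  exists2 c, c != 0 & forall i, F i = c * hcoord q 0 i.

(* f is a morphism of varieties: near every point it is given by homogeneous
   polynomials of the same degree without common zero. *)
Definition regular n r (X : pred 'P[k]_n) (Y : pred 'P[k]_r)
    (f : {p | p \in X} -> {q | q \in Y}) : Prop :=
  forall x0 : {p | p \in X}, exists d (F : 'I_r.+1 -> {mpoly k[n.+1]}),
  [/\ forall i, F i \is d.-homog,
      exists i, (F i).@[hcoord (val x0) 0] != 0 &
      forall x : {p | p \in X},
        (exists i, (F i).@[hcoord (val x) 0] != 0) ->
        represents (fun i => (F i).@[hcoord (val x) 0]) (val (f x))].

Definition hcoord2 n m (p : 'P[k]_n) (q : 'P[k]_m) : 'rV[k]_(n.+1 + m.+1) :=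
  row_mx (hcoord p) (hcoord q).

(* The same for a map out of a product of projective varieties, with
   bihomogeneous polynomials in the two sets of coordinates. *)
Definition regular2 n m r (X : pred 'P[k]_n) (Y : pred 'P[k]_m)
    (Z : pred 'P[k]_r)
    (f : {p | p \in X} -> {q | q \in Y} -> {s | s \in Z}) : Prop :=
  forall (x0 : {p | p \in X}) (y0 : {q | q \in Y}),
  exists d e (F : 'I_r.+1 -> {mpoly k[n.+1 + m.+1]}),
  [/\ forall i, F i \in bihomog d e,
      exists i, (F i).@[hcoord2 (val x0) (val y0) 0] != 0 &
      forall (x : {p | p \in X}) (y : {q | q \in Y}),
        (exists i, (F i).@[hcoord2 (val x) (val y) 0] != 0) ->
        represents (fun i => (F i).@[hcoord2 (val x) (val y) 0])
                   (val (f x y))].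

Record algebraic_group_law n (X : pred 'P[k]_n) := AlgebraicGroupLaw {
  gop : {p | p \in X} -> {p | p \in X} -> {p | p \in X};
  gid : {p | p \in X};
  ginv : {p | p \in X} -> {p | p \in X};
  gopA : associative gop;
  gop1x : left_id gid gop;
  gopx1 : right_id gid gop;
  gopVx : left_inverse gid ginv gop;
  gopxV : right_inverse gid ginv gop;
  gop_regular : regular2 gop;
  ginv_regular : regular ginv
}.

Definition two_torsion n (X : pred 'P[k]_n) (G : algebraic_group_law X) :
  pred {p | p \in X} := fun v => gop G v v == gid G.

End RegularMaps.

Section Curve.

Variable k : fieldType.

Definition quadric1 : {mpoly k[4]} := \sum_(i < 4) 'X_i ^+ 2.

Definition quadric2 (alpha gamma : k) : {mpoly k[4]} :=
  (1 - gamma) *: 'X_(1 : 'I_4) ^+ 2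
  + (1 + alpha * gamma) *: 'X_(2 : 'I_4) ^+ 2
  + (1 + alpha) *: 'X_(3 : 'I_4) ^+ 2.

Definition curveE (alpha gamma : k) : pred 'P[k]_3 :=
  zero_locus [:: quadric1; quadric2 alpha gamma].

End Curve.

(* The group {1, gamma_1, gamma_2, gamma_3} is written additively as Z/2 x Z/2,
   with gamma_1 = (1, 0), gamma_2 = (0, 1) and gamma_3 = (1, 1). *)
Definition Gamma : Type := ('Z_2 * 'Z_2)%type.

HB.instance Definition _ := GRing.Zmodule.on Gamma.
HB.instance Definition _ := Finite.on Gamma.

Definition gamma1 : Gamma := (1, 0).
Definition gamma2 : Gamma := (0, 1).
Definition gamma3 : Gamma := gamma1 + gamma2.

Section GammaAction.

Variable k : fieldType.

Definition Gamma_sign (g : Gamma) (i : 'I_4) : k :=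
  match val i with
  | 1%N => (-1) ^+ (g.2 : nat)
  | 2%N => (-1) ^+ (g.1 : nat)
  | 3%N => (-1) ^+ (g.1 : nat) * (-1) ^+ (g.2 : nat)
  | _ => 1
  end.

Definition Gamma_vec (g : Gamma) (v : 'rV[k]_4) : 'rV[k]_4 :=
  \row_i (Gamma_sign g i * v 0 i).

Definition coords4 (x0 x1 x2 x3 : k) : 'rV[k]_4 :=
  \row_i nth 0 [:: x0; x1; x2; x3] i.

Lemma sign_Z2D (a b : 'Z_2) :
  (-1) ^+ ((a + b)%R : nat) = (-1) ^+ (a : nat) * (-1) ^+ (b : nat) :> k.
Proof.
rewrite -exprD -[LHS]signr_odd -[RHS]signr_odd; congr (_ ^+ nat_of_bool _).
by case: a b => [[|[|a]] lta] // [[|[|b]] ltb].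
Qed.

Lemma Gamma_signD g h i :
  Gamma_sign (g + h) i = Gamma_sign g i * Gamma_sign h i.
Proof.
rewrite /Gamma_sign; case: (val i) => [|[|[|[|j]]]] /=;
by rewrite ?sign_Z2D ?mulr1 // mulrACA.
Qed.

Lemma Gamma_vec0 v : Gamma_vec 0 v = v.
Proof.
by apply/rowP=> -[[|[|[|[|i]]]] lti] //; rewrite mxE /Gamma_sign /= ?mul1r.
Qed.

Lemma Gamma_vec1 x0 x1 x2 x3 :
  Gamma_vec gamma1 (coords4 x0 x1 x2 x3) = coords4 x0 x1 (- x2) (- x3).
Proof.
by apply/rowP=> -[[|[|[|[|i]]]] lti] //;
  rewrite !mxE /Gamma_sign /= ?mulr1 ?mul1r ?mulN1r.
Qed.

Lemma Gamma_vec2 x0 x1 x2 x3 :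
  Gamma_vec gamma2 (coords4 x0 x1 x2 x3) = coords4 x0 (- x1) x2 (- x3).
Proof.
by apply/rowP=> -[[|[|[|[|i]]]] lti] //;
  rewrite !mxE /Gamma_sign /= ?mul1r ?mulN1r.
Qed.

Lemma Gamma_vec3 x0 x1 x2 x3 :
  Gamma_vec gamma3 (coords4 x0 x1 x2 x3) = coords4 x0 (- x1) (- x2) x3.
Proof.
apply/rowP=> i; rewrite mxE Gamma_signD -mulrA.
by case: i => -[|[|[|[|i]]]] lti //;
  rewrite !mxE /Gamma_sign /= ?mulr1 ?mul1r ?mulN1r ?opprK.
Qed.

Lemma Gamma_sign_sqr g i : Gamma_sign g i ^+ 2 = 1.
Proof.
by rewrite /Gamma_sign; case: (val i) => [|[|[|[|j]]]];
  rewrite ?exprMn ?sqrr_sign ?mulr1 ?expr1n.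
Qed.

Lemma Gamma_vecD g h v : Gamma_vec (g + h) v = Gamma_vec g (Gamma_vec h v).
Proof. by apply/rowP=> i; rewrite !mxE Gamma_signD mulrA. Qed.

Lemma Gamma_vecZ g c v : Gamma_vec g (c *: v) = c *: Gamma_vec g v.
Proof. by apply/rowP=> i; rewrite !mxE mulrCA. Qed.

Lemma Gamma_vecK g : involutive (Gamma_vec g).
Proof.
by move=> v; apply/rowP=> i; rewrite !mxE mulrA -expr2 Gamma_sign_sqr mul1r.
Qed.

Lemma Gamma_vec_neq0 g v : v != 0 -> Gamma_vec g v != 0.
Proof.
apply: contraNneq => gv0; rewrite -(Gamma_vecK g v) gv0.
by apply/eqP/rowP=> i; rewrite !mxE mulr0.
Qed.

Definition Gamma_act (g : Gamma) (p : 'P[k]_3) : 'P[k]_3 :=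
  proj_point (Gamma_vec_neq0 g (hcoord_neq0 p)).

Lemma Gamma_act_point g v (v0 : v != 0) :
  Gamma_act g (proj_point v0) = proj_point (Gamma_vec_neq0 g v0).
Proof.
have [c c0 vE] := proj_pointP v0 _ (eqxx _).
apply/eqP/eq_proj_point; exists c^-1; rewrite ?invr_eq0 //=.
by rewrite [in RHS]vE Gamma_vecZ scalerA mulVf // scale1r.
Qed.

Lemma Gamma_act0 p : Gamma_act 0 p = p.
Proof.
apply/esym/eqP/proj_pointP; exists 1; first exact: oner_neq0.
by rewrite Gamma_vec0 scale1r.
Qed.

Lemma Gamma_actD g h p : Gamma_act (g + h) p = Gamma_act g (Gamma_act h p).
Proof.
rewrite [Gamma_act h p]/Gamma_act Gamma_act_point; apply/eqP/eq_proj_point.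
by exists 1; rewrite ?oner_eq0 // scale1r Gamma_vecD.
Qed.

Lemma quadric1E (v : 'rV[k]_4) : (quadric1 k).@[v 0] = \sum_i v 0 i ^+ 2.
Proof.
rewrite raddf_sum /=; apply: eq_bigr => i _.
by rewrite !expr2 mevalM mevalXU.
Qed.

Lemma quadric2E alpha gamma (v : 'rV[k]_4) :
  (quadric2 alpha gamma).@[v 0]
    = (1 - gamma) * v 0 1 ^+ 2 + (1 + alpha * gamma) * v 0 2 ^+ 2
      + (1 + alpha) * v 0 3 ^+ 2.
Proof. by rewrite !mevalD !mevalZ !expr2 !mevalM !mevalXU. Qed.

Lemma quadrics_homog alpha gamma F :
  F \in [:: quadric1 k; quadric2 alpha gamma] -> F \is 2.-homog.
Proof.
have X2 i : ('X_i ^+ 2 : {mpoly k[4]}) \is 2.-homog.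
  by rewrite (dhomogMn 2 (d := 1%N)) // dhomogX; apply/eqP/mdeg1.
rewrite !inE => /orP[]/eqP->; first by apply: rpred_sum => i _; apply: X2.
by rewrite !rpredD // rpredZ.
Qed.

Lemma mem_curveE alpha gamma (v : 'rV[k]_4) (v0 : v != 0) :
  (proj_point v0 \in curveE alpha gamma)
    = (\sum_i v 0 i ^+ 2 == 0)
      && ((1 - gamma) * v 0 1 ^+ 2 + (1 + alpha * gamma) * v 0 2 ^+ 2
          + (1 + alpha) * v 0 3 ^+ 2 == 0).
Proof.
rewrite zero_locusE => [|F /quadrics_homog]; last exact: homogE.
by rewrite /= quadric1E quadric2E andbT.
Qed.

Lemma Gamma_act_curveE alpha gamma g p :
  p \in curveE alpha gamma -> Gamma_act g p \in curveE alpha gamma.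
Proof.
rewrite -{1}(hcoordK p) !mem_curveE => /andP[q1 q2].
rewrite !mxE !exprMn !Gamma_sign_sqr !mul1r q2 andbT.
by under eq_bigr do rewrite mxE exprMn Gamma_sign_sqr mul1r.
Qed.

Definition Gamma_curve alpha gamma (g : Gamma)
    (p : {p | p \in curveE alpha gamma}) : {p | p \in curveE alpha gamma} :=
  exist _ (Gamma_act g (val p)) (Gamma_act_curveE g (valP p)).

End GammaAction.

(* Main.v *)
(* After a diagonal change of coordinates, E is the curve
   x_2^2 = x_1^2 + a x_0^2, x_3^2 = x_1^2 + b x_0^2 with 0, a, b distinct, on
   which the classical addition formulas of the Jacobian elliptic functions
   give two addition laws of bidegree (2, 2). They agree where both are nonzero
   and never vanish simultaneously, so together they define a regular map.
   Associativity on all triples is the vanishing, modulo the equations of the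
   three points, of the 2 x 2 minors of the two iterated sums, for every choice
   of the laws used at the four additions. The identity is (0 : 1 : 1 : 1), the
   inverse changes the sign of x_0, and the formulas show that adding the
   image of the identity under an element of Gamma is the action of it. *)

Require Import Defs.
From mathcomp Require Import all_boot all_order all_algebra.
From mathcomp Require Import mpoly ring.

Set Implicit Arguments.
Unset Strict Implicit.
Unset Printing Implicit Defensive.

Import GRing.Theory.
Local Open Scope ring_scope.

(** * Vectors with four coordinates and proportionality by minors *)

Section Row4.

Variable R : comNzRingType.

Definition row4 (x0 x1 x2 x3 : R) : 'rV[R]_4 :=
  \row_i nth 0 [:: x0; x1; x2; x3] i.

(** Packed as a tuple so that it serves as one rewriting multirule. *)
Lemma row4E x0 x1 x2 x3 :
  ((row4 x0 x1 x2 x3 0 0 = x0) * (row4 x0 x1 x2 x3 0 1 = x1)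
   * (row4 x0 x1 x2 x3 0 2 = x2) * (row4 x0 x1 x2 x3 0 3 = x3))%type.
Proof. by rewrite !mxE. Qed.

End Row4.

Lemma forall_ord4 (P : 'I_4 -> Prop) :
  P 0 -> P 1 -> P 2 -> P 3 -> forall i, P i.
Proof.
move=> P0 P1 P2 P3 -[[|[|[|[|i]]]] lti] //.
- by rewrite (_ : Ordinal lti = 0) //; apply: val_inj.
- by rewrite (_ : Ordinal lti = 1) //; apply: val_inj.
- by rewrite (_ : Ordinal lti = 2) //; apply: val_inj.
- by rewrite (_ : Ordinal lti = 3) //; apply: val_inj.
Qed.

Lemma row4P (R : comNzRingType) (u v : 'rV[R]_4) :
  u 0 0 = v 0 0 -> u 0 1 = v 0 1 -> u 0 2 = v 0 2 -> u 0 3 = v 0 3 -> u = v.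
Proof. by move=> *; apply/rowP; apply: forall_ord4. Qed.

Lemma rV_neq0P (k : fieldType) n (u : 'rV[k]_n) :
  reflect (exists i, u 0 i != 0) (u != 0).
Proof.
apply: (iffP idP) => [u0|[i ui0]]; last first.
  by apply: contraNneq ui0 => ->; rewrite mxE.
apply/existsP; apply: contraNT u0 => /existsPn u0.
by apply/eqP/rowP=> i; rewrite mxE; apply/eqP/negbNE.
Qed.

(** Turns proportionality into six polynomial identities that [ring] can check; the ratio is read
    off at a nonzero coordinate of [u], and [v] may vanish. *)
Lemma minors_sub_rV (k : fieldType) (u v : 'rV[k]_4) :
  u != 0 ->
  u 0 0 * v 0 1 = u 0 1 * v 0 0 -> u 0 0 * v 0 2 = u 0 2 * v 0 0 ->
  u 0 0 * v 0 3 = u 0 3 * v 0 0 -> u 0 1 * v 0 2 = u 0 2 * v 0 1 ->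
  u 0 1 * v 0 3 = u 0 3 * v 0 1 -> u 0 2 * v 0 3 = u 0 3 * v 0 2 ->
  (v <= u)%MS.
Proof.
move=> /rV_neq0P[m um0] h01 h02 h03 h12 h13 h23.
have minor : forall i j, u 0 i * v 0 j = u 0 j * v 0 i.
  by apply: forall_ord4; apply: forall_ord4.
apply/sub_rVP; exists (v 0 m / u 0 m); apply/rowP=> i; rewrite mxE.
by rewrite mulrAC -[v 0 m * _]mulrC minor mulrAC divff // mul1r.
Qed.

(** * The Jacobi form of the curve and its two addition laws *)

Section AdditionLaws.

Variable R : comNzRingType.

(* With a = e_1 - e_2 and b = e_1 - e_3 this is the curve parametrized by
   (x_i / x_0)^2 = wp - e_i, where wp is a Weierstrass function. *)
Definition jac (a b : R) (x : 'rV[R]_4) : bool :=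
  (x 0 2 ^+ 2 == x 0 1 ^+ 2 + a * x 0 0 ^+ 2)
  && (x 0 3 ^+ 2 == x 0 1 ^+ 2 + b * x 0 0 ^+ 2).

(* The theta-like coordinates satisfy x_i(P + Q) x_j(P - Q) = M_ij(P, Q) for a
   matrix M of rank 1 of bidegree (2, 2); these are its columns 1 (j = true)
   and 0 (j = false), which vanish only where x_1(P - Q), respectively
   x_0(P - Q), does. *)
Definition law (a b : R) (j : bool) (x y : 'rV[R]_4) : 'rV[R]_4 :=
  if j then
    row4 (x 0 0 * x 0 1 * y 0 2 * y 0 3 + x 0 2 * x 0 3 * y 0 0 * y 0 1)
         (x 0 1 ^+ 2 * y 0 1 ^+ 2 - a * b * x 0 0 ^+ 2 * y 0 0 ^+ 2)
         (x 0 1 * x 0 2 * y 0 1 * y 0 2 + a * x 0 0 * x 0 3 * y 0 0 * y 0 3)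
         (x 0 1 * x 0 3 * y 0 1 * y 0 3 + b * x 0 0 * x 0 2 * y 0 0 * y 0 2)
  else
    row4 (x 0 0 ^+ 2 * y 0 1 ^+ 2 - x 0 1 ^+ 2 * y 0 0 ^+ 2)
         (x 0 0 * x 0 1 * y 0 2 * y 0 3 - x 0 2 * x 0 3 * y 0 0 * y 0 1)
         (x 0 0 * x 0 2 * y 0 1 * y 0 3 - x 0 1 * x 0 3 * y 0 0 * y 0 2)
         (x 0 0 * x 0 3 * y 0 1 * y 0 2 - x 0 1 * x 0 2 * y 0 0 * y 0 3).

Lemma lawZ a b j c d x y :
  law a b j (c *: x) (d *: y) = (c ^+ 2 * d ^+ 2) *: law a b j x y.
Proof.
by case: j; rewrite /law; apply: row4P;
   rewrite [in RHS]mxE !row4E !mxE; ring.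
Qed.

(** Exchanging P and Q negates P - Q; the coordinate [x_0] is odd and [x_1] is even, hence the
    sign. *)
Lemma lawC a b j x y : law a b j y x = (-1) ^+ (~~ j) *: law a b j x y.
Proof.
by case: j; rewrite /law; apply: row4P; rewrite [in RHS]mxE !row4E; ring.
Qed.

Lemma jac_law a b j x y :
  jac a b x -> jac a b y -> jac a b (law a b j x y).
Proof.
move=> /andP[/eqP x2 /eqP x3] /andP[/eqP y2 /eqP y3].
by case: j; rewrite /jac /law !row4E; apply/andP; split; apply/eqP;
   ring: x2 x3 y2 y3.
Qed.

End AdditionLaws.

(** Applied to evaluation of polynomials, this makes the same formulas serve as defining polynomials
    of a regular map. *)
Lemma map_law (R S : comNzRingType) (f : {rmorphism R -> S}) a b j x y :
  map_mx f (law a b j x y) = law (f a) (f b) j (map_mx f x) (map_mx f y).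
Proof.
by case: j; rewrite /law; apply: row4P;
   rewrite [in LHS]mxE !row4E !mxE !(rmorphD, rmorphN, rmorphM, rmorphXn).
Qed.

(** * Agreement of the two laws and associativity, by minors *)

Section Completeness.

Variables (k : fieldType) (a b : k).

Local Notation law := (law a b).
Local Notation jac := (jac a b).

Lemma law_collinear j l x y :
  jac x -> jac y -> law j x y != 0 -> (law l x y <= law j x y)%MS.
Proof.
move=> /andP[/eqP x2 /eqP x3] /andP[/eqP y2 /eqP y3].
by case: j l => -[] nz //; apply: minors_sub_rV; rewrite // !row4E;
   ring: x2 x3 y2 y3.
Qed.

Lemma lawA j l j' l' x y z :
  jac x -> jac y -> jac z -> law l (law j x y) z != 0 ->
  (law l' x (law j' y z) <= law l (law j x y) z)%MS.
Proof.
move=> /andP[/eqP x2 /eqP x3] /andP[/eqP y2 /eqP y3] /andP[/eqP z2 /eqP z3].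
(* In each of the 16 cases the minors vanish after the squares of coordinates 2 and 3 of the three
   points are eliminated. *)
by case: j l j' l' => -[] [] [] => nz; apply: minors_sub_rV; rewrite // !row4E;
  ring: x2 x3 y2 y3 z2 z3.
Qed.

End Completeness.

(** * The two laws have no common zero on the curve *)

Section NonVanishing.

Variables (k : fieldType) (a b : k).
Hypotheses (two_neq0 : 2 != 0 :> k) (a0 : a != 0) (b0 : b != 0) (ab : a != b).

Local Notation law := (law a b).
Local Notation jac := (jac a b).

(** A common zero would make [x_0] and [x_1] both vanish at P - Q, which no point of the curve
    allows. The algebraic proof uses only coordinates 0 and 1 of each law. *)
Lemma law_neq0 x y :
  x != 0 -> y != 0 -> jac x -> jac y -> exists j, law j x y != 0.
Proof.
move=> x_neq0 y_neq0 /andP[/eqP x2 /eqP x3] /andP[/eqP y2 /eqP y3].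
have jac_x1 (z : 'rV[k]_4) : z != 0 ->
    z 0 2 ^+ 2 = z 0 1 ^+ 2 + a * z 0 0 ^+ 2 ->
    z 0 3 ^+ 2 = z 0 1 ^+ 2 + b * z 0 0 ^+ 2 -> z 0 0 = 0 -> z 0 1 != 0.
  move=> z_neq0 z2 z3 z0; apply: contra_neq z_neq0 => z1.
  move: z2 z3; rewrite z0 z1 !expr0n /= !mulr0 addr0.
  by move=> /eqP + /eqP; rewrite !sqrf_eq0 => /eqP z2 /eqP z3; apply: row4P;
    rewrite mxE.
have [law0|] := eqVneq (law false x y) 0; last by exists false.
have [law1|] := eqVneq (law true x y) 0; last by exists true.
have : law true x y 0 0 = 0 by rewrite law1 mxE.
have : law true x y 0 1 = 0 by rewrite law1 mxE.
have : law false x y 0 0 = 0 by rewrite law0 mxE.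
have : law false x y 0 1 = 0 by rewrite law0 mxE.
rewrite !row4E => l01 l00 l11 l10.
have [xz|x0] := eqVneq (x 0 0) 0.
  have x1 : x 0 1 != 0 by apply: jac_x1.
  move/eqP: l00; rewrite xz expr0n /= mul0r sub0r oppr_eq0 mulf_eq0 !sqrf_eq0.
  rewrite (negPf x1) => /eqP yz; move/eqP: l11.
  rewrite xz expr0n /= mulr0 mul0r subr0 mulf_eq0 !sqrf_eq0 (negPf x1) /=.
  by move/eqP=> y1; have := jac_x1 y y_neq0 y2 y3 yz; rewrite y1 eqxx.
have [yz|y0] := eqVneq (y 0 0) 0.
  move/eqP: l00; rewrite yz expr0n /= mulr0 subr0 mulf_eq0 !sqrf_eq0 (negPf x0).
  by move/eqP=> y1; have := jac_x1 y y_neq0 y2 y3 yz; rewrite y1 eqxx.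
have xy1 : x 0 1 ^+ 2 * y 0 0 ^+ 2 = x 0 0 ^+ 2 * y 0 1 ^+ 2.
  by apply/esym/eqP; rewrite -subr_eq0 l00.
have [xz|x1] := eqVneq (x 0 1) 0.
  move/eqP: l11; rewrite xz expr0n /= mul0r sub0r oppr_eq0 !mulf_eq0.
  by rewrite (negPf a0) (negPf b0) (negPf x0) (negPf y0).
have y1 : y 0 1 != 0.
  apply: contraNneq x1 => yz; move/eqP: xy1.
  by rewrite yz expr0n /= mulr0 mulf_eq0 !sqrf_eq0 (negPf y0) orbF.
(* Subtracting [l01] from [l10] leaves twice a product; characteristic not 2 enters here. *)
have x23 : x 0 2 * x 0 3 = 0.
  have /eqP : 2 * (x 0 2 * x 0 3) * (y 0 0 * y 0 1) = 0.
    by rewrite -[RHS](subrr 0) -{1}l10 -l01; ring.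
  rewrite mulf_eq0 mulf_eq0 (negPf two_neq0) /= => /orP[/eqP //|].
  by rewrite mulf_eq0 (negPf y0) (negPf y1).
(* If coordinate 2 or 3 of [x] is zero, its equation gives the premise with [c = a] or [c = b]; the
   conclusion then forces [a = b]. *)
have l11x c : x 0 1 ^+ 2 = - c * x 0 0 ^+ 2 -> c ^+ 2 = a * b.
  move=> x1c; have x0y0 : x 0 0 ^+ 4 * y 0 0 ^+ 2 != 0.
    by rewrite mulf_neq0 ?expf_neq0.
  apply/(mulIf x0y0)/eqP; rewrite -subr_eq0; apply/eqP.
  transitivity (x 0 0 ^+ 2 * (x 0 1 ^+ 2 * y 0 1 ^+ 2
                              - a * b * x 0 0 ^+ 2 * y 0 0 ^+ 2)).
    by rewrite [RHS]mulrBr [X in _ = X - _]mulrCA -xy1 x1c; ring.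
  by rewrite l11 mulr0.
move/eqP: x23; rewrite mulf_eq0 => /orP[] /eqP xz.
  have /l11x : x 0 1 ^+ 2 = - a * x 0 0 ^+ 2.
    by apply/eqP; rewrite mulNr -addr_eq0 -x2 xz expr0n.
  by move/(mulfI a0)/eqP; rewrite (negPf ab).
have /l11x : x 0 1 ^+ 2 = - b * x 0 0 ^+ 2.
  by apply/eqP; rewrite mulNr -addr_eq0 -x3 xz expr0n.
by move/(mulIf b0)/esym/eqP; rewrite (negPf ab).
Qed.
End NonVanishing.

Definition base_vec (k : fieldType) : 'rV[k]_4 := row4 0 1 1 1.

Definition opp_vec (k : fieldType) (x : 'rV[k]_4) : 'rV[k]_4 :=
  row4 (- x 0 0) (x 0 1) (x 0 2) (x 0 3).

(** * Values of the laws at opposite points and at the images of the identity *)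

Section SpecialValues.

Variables (k : fieldType) (a b : k).

Lemma base_vec_neq0 : base_vec k != 0.
Proof. by apply/rV_neq0P; exists 1; rewrite row4E oner_eq0. Qed.

Lemma jac_base_vec : jac a b (base_vec k).
Proof. by rewrite /jac !row4E expr0n !mulr0 addr0 eqxx. Qed.

Lemma opp_vec_neq0 (x : 'rV[k]_4) : x != 0 -> opp_vec x != 0.
Proof.
apply: contraNneq => /rowP ox0; apply/eqP/row4P; rewrite mxE.
- by apply/eqP; rewrite -oppr_eq0; have := ox0 0; rewrite row4E mxE => ->.
- by have := ox0 1; rewrite row4E mxE.
- by have := ox0 2; rewrite row4E mxE.
- by have := ox0 3; rewrite row4E mxE.
Qed.

Lemma jac_opp_vec (x : 'rV[k]_4) : jac a b (opp_vec x) = jac a b x.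
Proof. by rewrite /jac !row4E sqrrN. Qed.

Lemma jacZ c (x : 'rV[k]_4) : c != 0 -> jac a b (c *: x) = jac a b x.
Proof.
move=> c0; have c20 : c ^+ 2 != 0 by rewrite expf_neq0.
rewrite /jac !mxE !exprMn ![_ * (c ^+ 2 * _)]mulrCA -!mulrDr.
by rewrite !(inj_eq (mulfI c20)).
Qed.

Lemma law_opp_vec j (x : 'rV[k]_4) :
  jac a b x -> (law a b j (opp_vec x) x <= base_vec k)%MS.
Proof.
move=> /andP[/eqP x2 /eqP x3]; apply/sub_rVP.
(* The factor is coordinate 1 of the sum, since [base_vec] has a 1 there; it may be zero. *)
exists (if j then x 0 1 ^+ 4 - a * b * x 0 0 ^+ 4
        else - 2 * (x 0 0 * x 0 1 * x 0 2 * x 0 3)).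
by case: j; rewrite /law /opp_vec; apply: row4P; rewrite [in RHS]mxE !row4E;
   ring: x2 x3.
Qed.

(** As coordinate 0 of the second argument is 0, each coordinate of the law reduces to a single
    monomial in [x], with common factor [x_1] up to sign, or [x_0]. The third sign is the product of
    the other two. *)
Lemma law_Gamma_base_vec j g (x : 'rV[k]_4) :
  (law a b j x (Gamma_vec g (base_vec k)) <= Gamma_vec g x)%MS.
Proof.
apply/sub_rVP; exists (if j then Gamma_sign k g 1 * x 0 1 else x 0 0).
have := Gamma_sign_sqr k g 1; have := Gamma_sign_sqr k g 2.
rewrite /law /base_vec; case: j => s2 s1; apply: row4P;
  rewrite [in RHS]mxE ?row4E !mxE /Gamma_sign /=; move: s1 s2;
  rewrite /Gamma_sign /=; move: ((-1) ^+ _) ((-1) ^+ _) => s1 s2 s1E s2E;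
  ring: s1E s2E.
Qed.

End SpecialValues.

(** * Addition on an abstract set of points with Jacobi coordinates *)

Section GroupStructure.

Variables (k : fieldType) (a b : k).
Hypotheses (two_neq0 : 2 != 0 :> k) (a0 : a != 0) (b0 : b != 0) (ab : a != b).

Variables (T : choiceType) (coord : T -> 'rV[k]_4).
Hypotheses
  (coord_neq0 : forall t, coord t != 0)
  (coord_jac : forall t, jac a b (coord t))
  (coord_surj : forall x : 'rV[k]_4,
     x != 0 -> jac a b x -> exists t, (x <= coord t)%MS)
  (coord_inj : forall s t, (coord s <= coord t)%MS -> s = t).

Local Notation law := (law a b).

Lemma sub_coordE (x : 'rV[k]_4) t : x != 0 -> (x <= coord t)%MS ->
  exists2 c, c != 0 & coord t = c *: x.
Proof.
move=> x0 /sub_rVP[c xE].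
have c0 : c != 0 by apply: contraNneq x0 => c0; rewrite xE c0 scale0r.
by exists c^-1; rewrite ?invr_eq0 // xE scalerA mulVf // scale1r.
Qed.

Lemma sub_coord_inj (x : 'rV[k]_4) s t :
  x != 0 -> (x <= coord s)%MS -> (x <= coord t)%MS -> s = t.
Proof.
move=> x0 /(sub_coordE x0)[c _ sE] xt; apply: coord_inj.
by rewrite sE scalemx_sub.
Qed.

Lemma law_coord_neq0 s t : exists j, law j (coord s) (coord t) != 0.
Proof. exact: law_neq0. Qed.

(** A nonzero law determines the point and the other law is proportional to it. The quantifier over
    [j] is boolean so that [xchoose] applies. *)
Lemma coord_add_ex s t :
  exists r, [forall j, law j (coord s) (coord t) <= coord r]%MS.
Proof.
have [j nz] := law_coord_neq0 s t.
have [r rP] := coord_surj nz (jac_law j (coord_jac s) (coord_jac t)).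
exists r; apply/forallP=> l; apply: submx_trans rP.
exact: law_collinear (coord_jac s) (coord_jac t) nz.
Qed.

Definition coord_add s t := xchoose (coord_add_ex s t).

Lemma law_sub_add j s t :
  (law j (coord s) (coord t) <= coord (coord_add s t))%MS.
Proof. exact: forallP (xchooseP (coord_add_ex s t)) j. Qed.

Lemma coord_add_eq s t r :
  (forall j, law j (coord s) (coord t) <= coord r)%MS -> coord_add s t = r.
Proof.
have [j nz] := law_coord_neq0 s t => /(_ j).
exact: sub_coord_inj nz (law_sub_add j s t).
Qed.

Lemma coord_addC : commutative coord_add.
Proof.
by move=> s t; apply: coord_add_eq => j; rewrite lawC scalemx_sub ?law_sub_add.
Qed.

Lemma coord_addA : associative coord_add.
Proof.
move=> s t r; apply/esym.
have [j nz_j] := law_coord_neq0 s t; have [j' nz_j'] := law_coord_neq0 t r.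
have [c c0 cE] := sub_coordE nz_j (law_sub_add j s t).
have [d d0 dE] := sub_coordE nz_j' (law_sub_add j' t r).
have [l nz_l] := law_coord_neq0 (coord_add s t) r.
have [l' nz_l'] := law_coord_neq0 s (coord_add t r).
(* A nonzero vector on both lines identifies the points. Replacing the inner sums by nonvanishing
   laws costs only the squares of [c] and [d], after which [lawA] compares the two sides. *)
apply: (sub_coord_inj nz_l' _ (law_sub_add l' _ _)).
apply: submx_trans (law_sub_add l _ _).
have lE : law l (coord (coord_add s t)) (coord r)
          = c ^+ 2 *: law l (law j (coord s) (coord t)) (coord r).
  by rewrite cE -{1}[coord r]scale1r lawZ expr1n mulr1.
rewrite dE -[coord s]scale1r lawZ scalemx_sub // lE.
rewrite eqmx_scale ?expf_neq0 // lawA //.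
by apply: contraNneq nz_l => l0; rewrite lE l0 scaler0.
Qed.

(** Here [o] is the identity, [t] its image under [g] and [v] that of [u]. The case [g = 0] gives
    the right identity law. *)
Lemma coord_add_Gamma g o t u v :
  (base_vec k <= coord o)%MS -> (Gamma_vec g (coord o) <= coord t)%MS ->
  (Gamma_vec g (coord u) <= coord v)%MS -> coord_add u t = v.
Proof.
move=> baseo ot uv; apply: coord_add_eq => j.
have [c c0 oE] := sub_coordE (base_vec_neq0 k) baseo.
have [d d0 tE] := sub_coordE (Gamma_vec_neq0 g (coord_neq0 o)) ot.
rewrite tE oE Gamma_vecZ scalerA -[coord u]scale1r lawZ scalemx_sub //.
exact: submx_trans (law_Gamma_base_vec _ _ _ _ _) uv.
Qed.

Lemma coord_add_opp o t u :
  (base_vec k <= coord o)%MS -> (opp_vec (coord t) <= coord u)%MS ->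
  coord_add u t = o.
Proof.
move=> baseo tu; apply: coord_add_eq => j.
have [c c0 uE] := sub_coordE (opp_vec_neq0 (coord_neq0 t)) tu.
rewrite uE -[X in law j _ X]scale1r lawZ scalemx_sub //.
exact: submx_trans (law_opp_vec j (coord_jac t)) baseo.
Qed.

End GroupStructure.

(** * Bidegrees of the addition laws *)

Section Bihomogeneous.

Variables (k : fieldType) (n m : nat).

Implicit Types F G : {mpoly k[n + m]}.

Lemma bihomogD d e F G :
  F \in bihomog d e -> G \in bihomog d e -> F + G \in bihomog d e.
Proof.
move=> /allP Fde /allP Gde; apply/allP=> M /msuppD_le.
by rewrite mem_cat => /orP[/Fde|/Gde].
Qed.

Lemma bihomogZ d e c F : F \in bihomog d e -> c *: F \in bihomog d e.
Proof. by move=> /allP Fde; apply/allP=> M /msuppZ_le/Fde. Qed.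

Lemma bihomogB d e F G :
  F \in bihomog d e -> G \in bihomog d e -> F - G \in bihomog d e.
Proof. by move=> Fde Gde; rewrite -scaleN1r bihomogD ?bihomogZ. Qed.

Lemma bihomogM d1 e1 d2 e2 F G :
  F \in bihomog d1 e1 -> G \in bihomog d2 e2 ->
  F * G \in bihomog (d1 + d2) (e1 + e2).
Proof.
move=> /allP Fde /allP Gde; apply/allP=> M /msuppM_le.
move=> /allpairsP[[M1 M2] /= [/Fde/andP[/eqP <- /eqP <-] + ->]].
move=> /Gde/andP[/eqP <- /eqP <-]; rewrite /mdegl /mdegr -!big_split /=.
by apply/andP; split; apply/eqP/eq_bigr=> i _; rewrite mnmDE.
Qed.

Lemma bihomogC c : (c%:MP : {mpoly k[n + m]}) \in bihomog 0 0.
Proof.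
apply/allP=> M; rewrite msuppC; case: ifP => // _; rewrite inE => /eqP->.
by rewrite /mdegl /mdegr !big1 // => i _; rewrite mnm0E.
Qed.

Lemma bihomogXl i : ('X_(lshift m i) : {mpoly k[n + m]}) \in bihomog 1 0.
Proof.
apply/allP=> M; rewrite msuppX inE => /eqP->; apply/andP; split; apply/eqP.
  rewrite /mdegl (bigD1 i) //= mnm1E eqxx big1 // => j ji.
  by rewrite mnm1E (inj_eq (@lshift_inj _ _)) eq_sym (negPf ji).
by rewrite /mdegr big1 // => j _; rewrite mnm1E eq_lrshift.
Qed.

Lemma bihomogXr i : ('X_(rshift n i) : {mpoly k[n + m]}) \in bihomog 0 1.
Proof.
apply/allP=> M; rewrite msuppX inE => /eqP->; apply/andP; split; apply/eqP.
  by rewrite /mdegl big1 // => j _; rewrite mnm1E eq_rlshift.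
rewrite /mdegr (bigD1 i) //= mnm1E eqxx big1 // => j ji.
by rewrite mnm1E (inj_eq (@rshift_inj _ _)) eq_sym (negPf ji).
Qed.

Lemma bihomog_law a b j (x y : 'rV[{mpoly k[n + m]}]_4) i :
  a \in bihomog 0 0 -> b \in bihomog 0 0 ->
  (forall l, x 0 l \in bihomog 1 0) -> (forall l, y 0 l \in bihomog 0 1) ->
  law a b j x y 0 i \in bihomog 2 2.
Proof.
move=> a0 b0 x1 y1.
(* The product rule yields degrees as sums of 0s and 1s; [cast] compares them with 2 afterwards. *)
have cast d e d' e' F : F \in bihomog d e -> d = d' -> e = e' ->
    F \in bihomog d' e' by move=> ? <- <-.
move: i; case: j; apply: forall_ord4; rewrite row4E ?expr2;
  first [apply: bihomogB | apply: bihomogD];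
  (eapply cast; first by do !eapply bihomogM;
   first [apply: x1 | apply: y1 | apply: a0 | apply: b0]); by [].
Qed.

End Bihomogeneous.

(** * Diagonal change of coordinates, compatible with the action of Gamma *)

Section DiagonalScaling.

Variable k : fieldType.

Definition diag_scale (o v : 'rV[k]_4) : 'rV[k]_4 :=
  \row_i (o 0 i * v 0 i).

Lemma diag_scaleZ o c v : diag_scale o (c *: v) = c *: diag_scale o v.
Proof. by apply/rowP=> i; rewrite !mxE mulrCA. Qed.

Lemma Gamma_vec_diag_scale g o v :
  Gamma_vec g (diag_scale o v) = diag_scale o (Gamma_vec g v).
Proof. by apply/rowP=> i; rewrite !mxE mulrCA. Qed.

Variables (o : 'rV[k]_4) (o_neq0 : forall i, o 0 i != 0).

Definition jcoord (p : 'P[k]_3) : 'rV[k]_4 :=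
  diag_scale (map_mx GRing.inv o) (hcoord p).

Lemma diag_scaleK v : diag_scale (map_mx GRing.inv o) (diag_scale o v) = v.
Proof. by apply/rowP=> i; rewrite !mxE mulKf. Qed.

Lemma diag_scaleVK v : diag_scale o (diag_scale (map_mx GRing.inv o) v) = v.
Proof. by apply/rowP=> i; rewrite !mxE mulVKf. Qed.

Lemma diag_scale_neq0 v : v != 0 -> diag_scale o v != 0.
Proof.
apply: contraNneq => v0; rewrite -[v]diag_scaleK v0.
by apply/eqP/rowP=> i; rewrite !mxE mulr0.
Qed.

Lemma hcoordE p : hcoord p = diag_scale o (jcoord p).
Proof. by rewrite diag_scaleVK. Qed.

Lemma jcoord_neq0 p : jcoord p != 0.
Proof.
apply: contraNneq (hcoord_neq0 p) => p0; rewrite hcoordE p0.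
by apply/eqP/rowP=> i; rewrite !mxE mulr0.
Qed.

Lemma jcoord_inj p q : (jcoord p <= jcoord q)%MS -> p = q.
Proof.
move=> /sub_rVP[c pq]; rewrite -(hcoordK p) -(hcoordK q).
apply/eqP/eq_proj_point; exists c; last first.
  by rewrite !hcoordE pq diag_scaleZ.
by apply: contraNneq (jcoord_neq0 p) => c0; rewrite pq c0 scale0r.
Qed.

Lemma sub_jcoord_point x (x0 : x != 0) :
  (x <= jcoord (proj_point (diag_scale_neq0 x0)))%MS.
Proof.
have [c c0 cE] := proj_pointP (diag_scale_neq0 x0) _ (eqxx _).
by apply/sub_rVP; exists c; rewrite -diag_scaleZ -cE diag_scaleK.
Qed.

Lemma sub_jcoord_Gamma g p :
  (Gamma_vec g (jcoord p) <= jcoord (Gamma_act g p))%MS.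
Proof.
have [c c0 cE] := proj_pointP (Gamma_vec_neq0 g (hcoord_neq0 p)) _ (eqxx _).
by apply/sub_rVP; exists c; rewrite -diag_scaleZ -cE Gamma_vec_diag_scale.
Qed.

End DiagonalScaling.
(* The scaling factors (0, o_1, o_2, o_3) are the coordinates of a point of the
   curve with x_0 = 0, which is the identity of the group law. *)
Lemma diagonal_pencil (k : fieldType) (a1 a2 a3 : k) (o y : 'rV[k]_4) :
  a1 != a2 -> a2 != a3 -> a3 != a1 ->
  o 0 0 ^+ 2 = (a1 - a2) * (a2 - a3) * (a1 - a3) ->
  o 0 1 ^+ 2 = a2 - a3 -> o 0 2 ^+ 2 = a3 - a1 -> o 0 3 ^+ 2 = a1 - a2 ->
  let x := diag_scale o y in
  (\sum_i x 0 i ^+ 2 == 0)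
  && (a1 * x 0 1 ^+ 2 + a2 * x 0 2 ^+ 2 + a3 * x 0 3 ^+ 2 == 0)
  = jac (a3 * (a2 - a1)) (a2 * (a3 - a1)) y.
Proof.
rewrite -subr_eq0 -[a2 == _]subr_eq0 -[a3 == _]subr_eq0 => a12 a23 a31.
move=> o0 o1 o2 o3 /=.
have -> : \sum_i diag_scale o y 0 i ^+ 2
        = o 0 0 ^+ 2 * y 0 0 ^+ 2 + o 0 1 ^+ 2 * y 0 1 ^+ 2
          + o 0 2 ^+ 2 * y 0 2 ^+ 2 + o 0 3 ^+ 2 * y 0 3 ^+ 2.
  under eq_bigr do rewrite mxE exprMn.
  rewrite 4!big_ord_recr big_ord0 /= add0r.
  by congr (_ + _ + _ + _); congr (o 0 _ ^+ 2 * y 0 _ ^+ 2); apply: val_inj.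
rewrite !mxE !exprMn o0 o1 o2 o3 /jac.
apply/andP/andP => -[/eqP e1 /eqP e2]; split; apply/eqP.
(* Eliminating coordinate 3 from the quadrics leaves the first Jacobi equation times
   [(a2 - a3) * (a3 - a1)]; the next case eliminates coordinate 2. *)
- apply: (mulfI a23); apply: (mulfI a31); apply/eqP; rewrite -subr_eq0.
  apply/eqP; have := congr2 (fun u v => u - a3 * v) e2 e1.
  by rewrite /= mulr0 subr0 => <-; ring.
- apply: (mulfI a23); apply: (mulfI a12); apply/eqP; rewrite -subr_eq0.
  apply/eqP; have := congr2 (fun u v => a2 * u - v) e1 e2.
  by rewrite /= mulr0 subr0 => <-; ring.
- by ring: e1 e2.
- by ring: e1 e2.
Qed.

Lemma sqrt_exists (k : closedFieldType) (c : k) : exists r, r ^+ 2 = c.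
Proof.
have [r rE] := solve_monicpoly (fun i => if i is 0%N then c else 0) (ltn0Sn 1).
by exists r; rewrite rE !big_ord_recr big_ord0 /= mul0r addr0 add0r mulr1.
Qed.

(** * The algebraic group law and translations on the projective curve *)

Section GroupLaw.

Variables (k : fieldType) (a b : k) (o : 'rV[k]_4) (X : pred 'P[k]_3).
Hypotheses (two_neq0 : 2 != 0 :> k) (a0 : a != 0) (b0 : b != 0) (ab : a != b).
Hypothesis o_neq0 : forall i, o 0 i != 0.
Hypothesis memX : forall p, (p \in X) = jac a b (jcoord o p).

Local Notation T := {p | p \in X}.

Definition pt_coord (t : T) : 'rV[k]_4 := jcoord o (val t).

Lemma pt_coord_neq0 t : pt_coord t != 0.
Proof. exact: jcoord_neq0. Qed.

Lemma pt_coord_jac t : jac a b (pt_coord t).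
Proof. by rewrite -memX (valP t). Qed.

Lemma pt_coord_surj (x : 'rV[k]_4) :
  x != 0 -> jac a b x -> exists t, (x <= pt_coord t)%MS.
Proof.
move=> x0 xjac; have xp := sub_jcoord_point o_neq0 x0.
have [c c0 pE] := sub_coordE x0 xp.
have pX : proj_point (diag_scale_neq0 o_neq0 x0) \in X.
  by rewrite memX pE jacZ.
by exists (exist (fun p => p \in X) _ pX).
Qed.

Lemma pt_coord_inj s t : (pt_coord s <= pt_coord t)%MS -> s = t.
Proof. by move/(jcoord_inj o_neq0)/val_inj. Qed.

Definition pt_add : T -> T -> T :=
  coord_add two_neq0 a0 b0 ab pt_coord_neq0 pt_coord_jac pt_coord_surj.

Lemma pt_opp_ex t : exists u, (opp_vec (pt_coord t) <= pt_coord u)%MS.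
Proof.
apply: pt_coord_surj; first exact/opp_vec_neq0/pt_coord_neq0.
by rewrite jac_opp_vec pt_coord_jac.
Qed.

Definition pt_opp t : T := xchoose (pt_opp_ex t).

Lemma represents_coord (v : 'rV[k]_4) (t : T) :
  v != 0 -> (v <= pt_coord t)%MS ->
  represents (fun i => o 0 i * v 0 i) (val t).
Proof.
move=> v0 /sub_rVP[c vE]; exists c => [|i].
  by apply: contraNneq v0 => c0; rewrite vE c0 scale0r.
by rewrite (hcoordE o_neq0) vE !mxE mulrCA.
Qed.

Lemma pt_opp_regular : regular pt_opp.
Proof.
(* A sign change commutes with the diagonal scaling, so one set of linear forms works at all
   points. *)
pose F (i : 'I_4) : {mpoly k[4]} := (if i == 0 then -1 else 1) *: 'X_i.
have FE t : (fun i => (F i).@[hcoord (val t) 0])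
         =1 (fun i => o 0 i * opp_vec (pt_coord t) 0 i).
  by apply: forall_ord4; rewrite row4E mevalZ mevalXU (hcoordE o_neq0) mxE /=
    ?mulN1r ?mul1r ?mulrN.
have nz (t : T) := opp_vec_neq0 (pt_coord_neq0 t).
move=> t; exists 1%N, F; split=> [i||u _].
- by rewrite rpredZ // dhomogX; apply/eqP/mdeg1.
- have [i ti] := rV_neq0P _ (nz t).
  by exists i; rewrite [_.@[_]]FE mulf_neq0.
- have [c c0 E] := represents_coord (nz u) (xchooseP (pt_opp_ex u)).
  by exists c => // i; rewrite [LHS]FE E.
Qed.

Lemma pt_add_regular : regular2 pt_add.
Proof.
move=> s t.
have [j nz] := law_neq0 two_neq0 a0 b0 ab (pt_coord_neq0 s) (pt_coord_neq0 t)
                 (pt_coord_jac s) (pt_coord_jac t).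
pose x : 'rV[{mpoly k[4 + 4]}]_4 := \row_i ((o 0 i)^-1 *: 'X_(lshift 4 i)).
pose y : 'rV[{mpoly k[4 + 4]}]_4 := \row_i ((o 0 i)^-1 *: 'X_(rshift 4 i)).
(* The law [j] nonzero at [(s, t)], conjugated by the scaling; wherever it is nonzero it represents
   the sum. *)
pose F i : {mpoly k[4 + 4]} := o 0 i *: law a%:MP b%:MP j x y 0 i.
have FE u v i : (F i).@[hcoord2 (val u) (val v) 0]
              = o 0 i * law a b j (pt_coord u) (pt_coord v) 0 i.
  rewrite mevalZ; congr (_ * _); set h := hcoord2 _ _ 0.
  have -> : law a b j (pt_coord u) (pt_coord v)
          = map_mx (meval h) (law a%:MP b%:MP j x y).
    rewrite map_law /= !mevalC; congr (law _ _ _ _ _); apply/rowP=> l;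
      by rewrite !mxE mevalZ mevalXU /h /hcoord2 ?row_mxEl ?row_mxEr.
  by rewrite mxE.
exists 2, 2, F; split=> [i||u v [i ui]].
- by apply/bihomogZ/bihomog_law=> [||l|l]; rewrite ?mxE ?bihomogC //;
    apply: bihomogZ; [apply: bihomogXl | apply: bihomogXr].
- by have [i ni] := rV_neq0P _ nz; exists i; rewrite FE mulf_neq0.
have uv0 : law a b j (pt_coord u) (pt_coord v) != 0.
  by apply: contraNneq ui => uv0; rewrite FE uv0 mxE mulr0.
have [c c0 E] := represents_coord uv0 (law_sub_add two_neq0 a0 b0 ab
  pt_coord_neq0 pt_coord_jac pt_coord_surj j u v).
by exists c => // l; rewrite FE E.
Qed.

Lemma group_law_exists :
  exists (G : algebraic_group_law X) (e : T),
    [/\ (base_vec k <= pt_coord e)%MS, gid G = e & gop G = pt_add].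
Proof.
have [e eP] := pt_coord_surj (base_vec_neq0 k) (jac_base_vec a b).
have addx1 : right_id e pt_add.
  move=> t.
  by apply: (@coord_add_Gamma _ _ _ _ _ _ _ _ _ _ _ _ pt_coord_inj 0 e);
    rewrite ?Gamma_vec0.
have addVx : left_inverse e pt_opp pt_add.
  move=> t; apply: (coord_add_opp _ _ _ _ _ _ _ pt_coord_inj eP).
  exact: xchooseP (pt_opp_ex t).
have addC : commutative pt_add by apply: coord_addC; apply: pt_coord_inj.
have addA : associative pt_add by apply: coord_addA; apply: pt_coord_inj.
have add1x : left_id e pt_add by move=> t; rewrite addC.
have addxV : right_inverse e pt_opp pt_add by move=> t; rewrite addC.
by exists (AlgebraicGroupLaw addA add1x addx1 addVx addxV
             pt_add_regular pt_opp_regular), e.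
Qed.

Lemma Gamma_translation :
  exists G : algebraic_group_law X,
    forall g (f : T -> T), (forall t, val (f t) = Gamma_act g (val t)) ->
    exists2 t : T, t \in two_torsion G & forall v, f v = gop G v t.
Proof.
have [G [e [eP eE opE]]] := group_law_exists.
exists G => g f fE.
have fP t : (Gamma_vec g (pt_coord t) <= pt_coord (f t))%MS.
  by rewrite /pt_coord fE sub_jcoord_Gamma.
have f_transl v : f v = gop G v (f e).
  rewrite opE; apply/esym.
  exact: (@coord_add_Gamma _ _ _ _ _ _ _ _ _ _ _ _ pt_coord_inj g e).
(* Doubling [f e] is applying [f] to it, that is, applying [g + g = 0] to [e]. *)
exists (f e) => //; rewrite unfold_in eE -f_transl; apply/eqP/val_inj.
rewrite !fE -Gamma_actD.
suff -> : g + g = 0 by rewrite Gamma_act0.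
by move: g {f fE fP f_transl} => [[[|[|?]] ?] [[|[|?]] ?]] //; apply/eqP.
Qed.

End GroupLaw.

(** * Nondegeneracy of the pencil of quadrics and the conclusion *)

Theorem theorem7p6 (k : closedFieldType) (alpha beta gamma : k)
    (char_neq2 : 2%N \notin [pchar k])
    (sum_eq0 : alpha + beta + gamma + alpha * beta * gamma = 0)
    (alphaN : alpha \notin [:: 0; 1; -1])
    (betaN : beta \notin [:: 0; 1; -1])
    (gammaN : gamma \notin [:: 0; 1; -1]) :
  exists G : algebraic_group_law (curveE alpha gamma),
    forall g : Gamma, exists2 t : {p | p \in curveE alpha gamma},
      t \in two_torsion G &
      forall v : {p | p \in curveE alpha gamma}, Gamma_curve g v = gop G v t.
Proof.
have two_neq0 : 2 != 0 :> k by move: char_neq2; rewrite inE /=.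
move: alphaN betaN gammaN; rewrite !inE !negb_or.
move=> /and3P[al0 al1 alN1] /and3P[be0 be1 beN1] /and3P[ga0 ga1 gaN1].
have al_sq : 1 - alpha ^+ 2 != 0.
  by rewrite subr_eq0 eq_sym sqrf_eq1 negb_or al1.
set a1 := 1 - gamma; set a2 := 1 + alpha * gamma; set a3 := 1 + alpha.
have a1_neq0 : a1 != 0 by rewrite subr_eq0 eq_sym.
have a3_neq0 : a3 != 0 by rewrite /a3 addrC addr_eq0.
(* If [a2 = 0], the relation reduces to [alpha + gamma = 0], so [a2 = 1 - alpha ^+ 2], which is
   nonzero. *)
have a2_neq0 : a2 != 0.
  apply: contraNneq al_sq => a2_0; apply/eqP.
  have ag : alpha + gamma = 0.
    by rewrite -[RHS]sum_eq0 -[LHS]addr0 -(mulr0 beta) -a2_0 /a2; ring.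
  by rewrite -[RHS]a2_0 /a2 (_ : gamma = - alpha) ?expr2 ?mulrN //;
    apply/eqP; rewrite -addr_eq0 addrC ag.
have a12 : a1 != a2.
  rewrite -subr_eq0 (_ : _ - _ = - (gamma * a3)).
    by rewrite oppr_eq0 mulf_neq0.
  by rewrite /a1 /a2 /a3; ring.
have a23 : a2 != a3.
  rewrite -subr_eq0 (_ : _ - _ = - (alpha * a1)).
    by rewrite oppr_eq0 mulf_neq0.
  by rewrite /a1 /a2 /a3; ring.
(* Equality means [gamma = - alpha], and the relation becomes [beta * (1 - alpha ^+ 2) = 0]. *)
have a31 : a3 != a1.
  apply: contraNneq be0 => a31; have ag : gamma = - alpha.
    by apply: (addrI 1); rewrite -[LHS]subr0 -(subrr a3) {2}a31 /a1 /a3; ring.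
  have /eqP : beta * (1 - alpha ^+ 2) = 0.
    by rewrite -[RHS]sum_eq0 ag; ring.
  by rewrite mulf_eq0 (negPf al_sq) orbF.
(* The scaling factors are the square roots required by [diagonal_pencil]. *)
have [o0 o0E] := sqrt_exists ((a1 - a2) * (a2 - a3) * (a1 - a3)).
have [o1 o1E] := sqrt_exists (a2 - a3).
have [o2 o2E] := sqrt_exists (a3 - a1).
have [o3 o3E] := sqrt_exists (a1 - a2).
pose o := row4 o0 o1 o2 o3.
have o_neq0 i : o 0 i != 0.
  rewrite -sqrf_eq0; move: i; apply: forall_ord4;
  by rewrite row4E ?o0E ?o1E ?o2E ?o3E ?mulf_neq0 // subr_eq0 // eq_sym.
have memE p : (p \in curveE alpha gamma)
    = jac (a3 * (a2 - a1)) (a2 * (a3 - a1)) (jcoord o p).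
  rewrite -(diagonal_pencil (o := o)) ?row4E // -hcoordE //.
  by rewrite -{1}(hcoordK p) mem_curveE.
have [||| G GP] := Gamma_translation two_neq0 _ _ _ o_neq0 memE.
- by rewrite mulf_neq0 // subr_eq0 eq_sym.
- by rewrite mulf_neq0 // subr_eq0.
- rewrite -subr_eq0 (_ : _ - _ = a1 * (a2 - a3)); last by ring.
  by rewrite mulf_neq0 // subr_eq0.
by exists G => g; apply: (GP g).
Qed.
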